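(* Let $HEX$ be the infinite hexagonal grid. Then $\textrm{ERR:LD\%}(HEX) = \frac{3}{4}$.
   Context: $HEX$ is the infinite hexagonal (honeycomb) grid, the 3-regular graph of vertices and edges of the tiling of the plane by regular hexagons (equivalently, vertex set $\mathbb{Z}^2$ with $(i,j)$ adjacent to $(i\pm1,j)$ for all $i,j$, and $(i,j)$ adjacent to $(i,j+1)$ when $i+j$ is even). $N(v)$ is the open neighborhood of $v$ and $N[v]=N(v)\cup\{v\}$. ERR:LD sets (error-correcting locating-dominating sets) of a graph $G$: $S \subseteq V(G)$ is a set of detectors. At most one intruder is present, located at some vertex. A correctly working detector $v\in S$ transmits $2$ if the intruder is at $v$, $1$ if the intruder is in $N(v)$, and $0$ otherwise. At most one detector may transmit an incorrect value. $S$ is an ERR:LD set if, from the transmitted values, one can always determine whether an intruder is present and, if so, its exact location. Equivalently: $|N[v] \cap S| \ge 3$ for all $v\in V(G)$, and $|((N(v) \cap S) \triangle (N(u) \cap S)) - \{v,u\}| \ge 3 - |\{v,u\}\cap S|$ for all distinct $u,v\in V(G)$. $\textrm{ERR:LD\%}(G)$ denotes the minimum possible value of the density of an ERR:LD set $S$ for $G$, where the density of $S$ is the proportion of the vertices of $G$ that lie in $S$, formally $\limsup_{r\to\infty} \frac{|B_r(v)\cap S|}{|B_r(v)|}$ for any vertex $v\in V(G)$, with $B_r(v)=\{u\in V(G): d(u,v)\le r\}$. *)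

(* Defs.v *)
From HB Require Import structures.
From mathcomp Require Import all_boot all_order all_algebra.
From mathcomp Require Import finmap zify.
From mathcomp Require Import all_classical all_reals all_analysis.

Set Implicit Arguments.
Unset Strict Implicit.
Unset Printing Implicit Defensive.

Import Order.TTheory GRing.Theory Num.Theory.

Local Open Scope classical_set_scope.
Local Open Scope ring_scope.

Record graph := Graph {
  vertex :> choiceType;
  adj : rel vertex;
  adj_sym : symmetric adj;
  adj_irrefl : irreflexive adj }.

Arguments adj {g}.

(* [x = None] means that no intruder is present. *)
Definition correct_signal (G : graph) (x : option G) (w : G) : 'I_3 :=
  if x is Some v then
    if w == v then inord 2 else if adj w v then inord 1 else inord 0
  else inord 0.

(* A transmission is defined on the detectors only; [detects_as t x] says that
   [t] can be observed in situation [x], i.e. that at most one detector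
   deviates from its correct signal. *)
Definition detects_as (G : graph) (S : set G) (t : S -> 'I_3) (x : option G) :
    Prop :=
  forall a b : S,
    t a != correct_signal x (val a) -> t b != correct_signal x (val b) -> a = b.

Definition ERR_LD (G : graph) (S : set G) : Prop :=
  exists decode : (S -> 'I_3) -> option G,
    forall (t : S -> 'I_3) (x : option G), detects_as t x -> decode t = x.

(* In [path adj v p] the walk is [v :: p], so [size p] is its length. *)
Definition gball (G : graph) (v : G) (r : nat) : set G :=
  [set u | exists p : seq G,
    [/\ path adj v p, last v p = u & (size p <= r)%N]].

(* [fset_set] of an infinite set is empty, so this is meaningful for locally
   finite graphs, whose balls are finite. *)
Definition density (R : realType) (G : graph) (v : G) (S : set G) : \bar R :=
  limn_esup (fun r : nat =>
    (#|` fset_set (gball v r `&` S)|%:R / #|` fset_set (gball v r)|%:R)%:E).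

(* The value is attained by a set whose density is [d] as seen from every base
   vertex, and no set has a smaller density as seen from any base vertex, so
   nothing depends on the choice of the base vertex. *)
Definition is_ERR_LD_density (R : realType) (G : graph) (d : \bar R) : Prop :=
  (exists2 S : set G, ERR_LD S & forall v : G, density R v S = d) /\
  (forall S : set G, ERR_LD S -> forall v : G, (d <= density R v S)%E).

Definition hex_adj : rel (int * int)%type := fun u v =>
  [|| (u.2 == v.2) && ((v.1 == u.1 + 1) || (u.1 == v.1 + 1)),
      [&& u.1 == v.1, v.2 == u.2 + 1 & (2 %| u.1 + u.2)%Z] |
      [&& u.1 == v.1, u.2 == v.2 + 1 & (2 %| v.1 + v.2)%Z]].

Lemma hex_adj_sym : symmetric hex_adj.
Proof.
move=> [i j] [k l]; rewrite /hex_adj /= (eq_sym j l) (eq_sym i k).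
by rewrite [(k == i + 1) || _]orbC [X in _ || X]orbC.
Qed.

Lemma hex_adj_irrefl : irreflexive hex_adj.
Proof. by move=> [i j]; rewrite /hex_adj /=; lia. Qed.

Definition HEX : graph := Graph hex_adj_sym hex_adj_irrefl.

(* Main.v *)
(* In a cubic graph a detector set S must contain three vertices of every
   closed neighbourhood: the complement contains at most one vertex of each, so
   non-detectors have three detector neighbours and detectors have at most one
   non-detector neighbour. Double counting the edges between S and its
   complement gives 3 |B_r \ S| <= |B_(r+1) & S|, i.e. density at least 3/4 up
   to boundary terms. As HEX has no cycle of length 3 or 4, this neighbourhood
   condition is also sufficient, so the complement of the perfect code
   {(i, j) | 4 divides i + 2 j} is an ERR:LD set, and it attains equality. The
   boundary terms are negligible because balls grow quadratically and spheres
   linearly, which follows from an explicit formula for the distance. *)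
Require Import Defs.
From HB Require Import structures.
From mathcomp Require Import all_boot all_order all_algebra.
From mathcomp Require Import finmap zify lra.
From mathcomp Require Import all_classical all_reals all_analysis.

Set Implicit Arguments.
Unset Strict Implicit.
Unset Printing Implicit Defensive.

Import Order.TTheory GRing.Theory Num.Theory.

Local Open Scope classical_set_scope.
Local Open Scope ring_scope.

(** * Separation criteria for detector sets *)

(* At least three detectors tell x from y: no two vertices a, b exhaust them. *)
Lemma ERR_LDP (G : graph) (S : set G) :
  ERR_LD S <-> forall x y : option G, x <> y -> forall a b : G,
    exists w, [/\ S w, w <> a, w <> b &
                  correct_signal x w != correct_signal y w].
Proof.
split=> [[decode dec] x y xy a b|sep].
  apply: contrapT => nsep; apply: xy.
  (* This transmission follows [x] at [a] and [y] elsewhere. Without a further separating detector,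
     only [b] can deviate from [x] and only [a] from [y], so it must decode to both. *)
  pose t (w : S) :=
    if val w == a then correct_signal x (val w) else correct_signal y (val w).
  have sep w :
      S w -> correct_signal x w != correct_signal y w -> w <> a -> w = b.
    by move=> Sw xyw wa; apply: contrapT => wb; apply: nsep; exists w.
  have tx : forall w : S, t w != correct_signal x (val w) -> val w = b.
    move=> w; rewrite /t; have [_|/eqP wa] := eqVneq (val w) a.
      by rewrite eqxx.
    by rewrite eq_sym => xyw; apply: sep => //; exact: set_valP.
  have ty : forall w : S, t w != correct_signal y (val w) -> val w = a.
    by move=> w; rewrite /t; have [//|_] := eqVneq (val w) a; rewrite eqxx.
  rewrite -(dec t x) ?(dec t y) // => c d /[dup] + /[dup].
    by move=> _ /ty ca _ /ty da; apply: val_inj; rewrite ca da.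
  by move=> _ /tx ca _ /tx da; apply: val_inj; rewrite ca da.
pose decode (t : S -> 'I_3) := xget None [set x | detects_as t x].
exists decode => t x tx; rewrite /decode.
case: xgetP => [y _ ty|/(_ x)//].
apply: contrapT => yx.
(* An error-free transmission still needs some vertex as its possible error site; since [x] and [y]
   differ, one of them supplies it. *)
have [v0 _] : exists v : G, True.
  by case: x y yx {tx ty} => [v|] [v'|]//; exists v || exists v'.
have err z : detects_as t z ->
    exists a, forall w : S, t w != correct_signal z (val w) -> val w = a.
  move=> tz.
  have [[c cz]|nc] := pselect (exists c, t c != correct_signal z (val c)).
    by exists (val c) => w wz; rewrite (tz w c).
  by exists v0 => w wz; case: nc; exists w.
have [a ax] := err _ tx; have [b yb] := err _ ty.
have [w [Sw wa wb /eqP[]]] := sep _ _ yx a b.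
pose c : S := SigSub (mem_set Sw).
have <- : t c = correct_signal y w.
  by apply/eqP/negPn/negP => /(yb c).
by apply/eqP/negPn/negP => /(ax c).
Qed.

(** Distinct [u] and [v] have at most one common neighbour [m], and every detector of the closed
    neighbourhood of [u] or [v] other than [m] separates them. A detector near [u] and one near [v],
    both avoiding [m] and [a], cannot both be [b]. *)
Lemma ERR_LD_girth5 (G : graph) (S : set G) :
  (forall u v w : G, adj u v -> adj v w -> ~~ adj u w) ->
  (forall u v w w' : G, u <> v ->
    adj u w -> adj w v -> adj u w' -> adj w' v -> w = w') ->
  ERR_LD S <-> forall v a b : G,
    exists w, [/\ S w, w <> a, w <> b & (w == v) || adj w v].
Proof.
move=> no3 no4; rewrite ERR_LDP; split=> [sep v a b|dom x y xy a b].
  have [//|w [Sw wa wb]] := sep (Some v) None _ a b.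
  rewrite /correct_signal; case: (eqVneq w v) => [wv|wv].
    by exists w; rewrite wv eqxx; split=> //; rewrite -wv.
  by case: ifP => [wv' _|_]; [exists w; rewrite wv' orbT|by rewrite eqxx].
have sepN z : exists w : G, [/\ S w, w <> a, w <> b &
    correct_signal (Some z) w != correct_signal None w].
  have [w [Sw wa wb wz]] := dom z a b; exists w; split=> //.
  rewrite /correct_signal; case: (eqVneq w z) wz => [_ _|_ /= ->];
    by rewrite -val_eqE /= !inordK.
case: x y xy => [u|] [v|] // uv; last first.
  by have [w [? ? ? h]] := sepN v; exists w; split=> //; rewrite eq_sym.
have {}uv : u <> v by congruence.
have sep z z' w : (w == z) || adj w z -> z <> z' -> ~~ (adj w z && adj w z') ->
    correct_signal (Some z) w != correct_signal (Some z') w.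
  rewrite /correct_signal; case: (eqVneq w z) => [-> _ /eqP/negPf->|wz /= -> _ /=].
    by case: ifP => _ _; rewrite -val_eqE /= !inordK.
  by case: (eqVneq w z') => [_ _|_ /negPf->]; rewrite -val_eqE /= !inordK.
have [[m [mu mv]]|nom] := pselect (exists m, adj m u /\ adj m v); last first.
  have [w [Sw wa wb wu]] := dom u a b; exists w; split=> //.
  by apply: sep => //; apply/negP => /andP ?; apply: nom; exists w.
have uvN : ~~ adj u v by apply: no3 mv; rewrite adj_sym.
have uniq_m w : w <> m -> ~~ (adj w u && adj w v).
  move=> wm; apply/negP => /andP[wu wv]; apply: wm.
  by apply: (no4 u v) => //; rewrite adj_sym.
have [w1 [Sw1 w1m w1a w1u]] := dom u m a.
have [w1b|/eqP w1b] := eqVneq w1 b; last first.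
  by exists w1; split=> //; apply: sep => //; exact: uniq_m.
have [w2 [Sw2 w2m w2a w2v]] := dom v m a.
exists w2; split=> //; last first.
  rewrite eq_sym; apply: sep => //; first exact: nesym.
  by rewrite andbC; exact: uniq_m.
rewrite -w1b => w21; rewrite -w21 in w1u.
have /negP wm := uniq_m _ w2m.
(* A vertex other than [m] in both closed neighbourhoods would give [u = v], an edge [uv] closing a
   triangle with [m], or a second common neighbour. *)
case/orP: w1u => [/eqP w2u|w2u]; case/orP: w2v => [/eqP w2v|w2v].
- by apply: uv; rewrite -w2u.
- by move: uvN; rewrite -w2u w2v.
- by move: uvN; rewrite -w2v adj_sym w2u.
- by apply: wm; rewrite w2u.
Qed.

(** * Neighbours and distance in the honeycomb *)

Definition updown (i j : int) : int := if (2 %| i + j)%Z then j + 1 else j - 1.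

Definition nbr (k : 'I_3) (u : int * int) : int * int :=
  match val k with
  | 0 => (u.1 + 1, u.2) | 1 => (u.1 - 1, u.2) | _ => (u.1, updown u.1 u.2)
  end.

Lemma hex_adjP u w : reflect (exists k, w = nbr k u) (hex_adj u w).
Proof.
case: u w => [i j] [k l]; apply: (iffP idP) => [|[[[|[|[|//]]] ?] ->]]; last first.
- by rewrite /hex_adj /nbr /updown /=; case: ifP; lia.
- by rewrite /hex_adj /nbr /=; lia.
- by rewrite /hex_adj /nbr /=; lia.
rewrite /hex_adj /= => h.
have [->|[->|->]] :
    (k, l) = (i + 1, j) \/ (k, l) = (i - 1, j) \/ (k, l) = (i, updown i j).
  case/orP: h => [/andP[/eqP -> /orP[/eqP ->|/eqP ->]]|].
  - by left.
  - by right; left; apply/eqP; rewrite xpair_eqE; lia.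
  by case/orP => /and3P[/eqP -> /eqP ->]; right; right; rewrite /updown;
    case: ifP => ?; apply/eqP; rewrite xpair_eqE; lia.
by exists 0.
by exists 1.
by exists 2.
Qed.

(* [hex_norm p x y] is the distance from [v] to [v + (x, y)], where [p] says
   that the coordinates of [v] have an even sum. Two vertical steps in the same
   direction are always separated by a horizontal one, so a height difference
   [y] takes at least [2 * `|y| - 1] steps, or [2 * `|y|] if the first vertical
   step is not available at [v]; [%% 2] rounds this up to the parity imposed by
   the bipartition. *)
Definition hex_norm (p : bool) (x y : int) : nat :=
  let g := (2 * `|y| - (if p then (0 < y)%R else (y < 0)%R))%N in
  maxn (`|x| + `|y|) (g + (g + `|x| + `|y|) %% 2).

Arguments hex_norm p (x y)%_R.

Definition hex_dist (v u : int * int) : nat :=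
  hex_norm (2 %| v.1 + v.2)%Z (u.1 - v.1) (u.2 - v.2).

Lemma hex_normNl p x y : hex_norm p (- x) y = hex_norm p x y.
Proof. by rewrite /hex_norm abszN. Qed.

(** Reflection in the horizontal axis swaps the two vertex classes, so vertical steps and descent
    are studied for [p = true] only. *)
Lemma hex_norm_false x y : hex_norm false x y = hex_norm true x (- y).
Proof. by rewrite /hex_norm abszN oppr_gt0. Qed.

Lemma hex_norm_addl p x y : (hex_norm p (x + 1) y <= (hex_norm p x y).+1)%N.
Proof.
rewrite /hex_norm; set g := (_ - _)%N; rewrite -maxnSS geq_max !leq_max.
by apply/andP; split; apply/orP; [left|right]; lia.
Qed.

(** For an even base point, the hypothesis says that the edge from [(x, y)] up to [(x, y + 1)]
    exists; the next lemma crosses the same edge downwards. *)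
Lemma hex_norm_addr x y : (2 %| x + y)%Z ->
  (hex_norm true x (y + 1) <= (hex_norm true x y).+1)%N.
Proof.
rewrite /hex_norm => xy.
have [y0|y0] := ltP 0 y.
  by rewrite (_ : 0 < y + 1); lia.
have [y0'|y0'] := ltP 0 (y + 1).
  by have -> : y = 0; lia.
by lia.
Qed.

Lemma hex_norm_subr x y : (2 %| x + y)%Z ->
  (hex_norm true x y <= (hex_norm true x (y + 1)).+1)%N.
Proof.
rewrite /hex_norm => xy.
have [y0|y0] := ltP 0 y.
  by rewrite (_ : 0 < y + 1); lia.
have [y0'|y0'] := ltP 0 (y + 1).
  by have -> : y = 0; lia.
by lia.
Qed.

(* Descent: step vertically towards [0] if that edge is present, and
   horizontally towards [0] otherwise. *)
Lemma hex_norm_pred x y : (0 < hex_norm true x y)%N ->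
  [\/ (hex_norm true (x + 1) y < hex_norm true x y)%N,
      (hex_norm true (x - 1) y < hex_norm true x y)%N |
      (hex_norm true x (if (2 %| x + y)%Z then y + 1 else y - 1)%R
        < hex_norm true x y)%N].
Proof.
have horizontal : (2 %| x + y)%Z = (0 < y) -> (0 < hex_norm true x y)%N ->
    (hex_norm true (if x < 0 then x + 1 else x - 1)%R y < hex_norm true x y)%N.
  rewrite /hex_norm => xy.
  by have [y0|y0] := ltP 0 y; have [x0|x0] := ltP x 0; lia.
move=> xy0; have [xy|xy] := eqVneq (2 %| x + y)%Z (0 < y).
  by move: (horizontal xy xy0); case: ifP => _; [apply: Or31|apply: Or32].
(* On the row [y = 0] the vertical edge leads away from the origin in this case, so the step is
   horizontal. *)
have [y0|y0] := eqVneq y 0.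
  move: xy0; rewrite /hex_norm => xy0.
  have [x0|x0] := ltP x 0; [apply: Or31|apply: Or32]; lia.
apply: Or33; move: xy xy0; rewrite /hex_norm => xy _.
case: ifP xy => xy; have [y1|y1] := ltP 0 y => // _.
  by have [y2|y2] := ltP 0 (y + 1); lia.
have [y2|y2] := ltP 0 (y - 1); first by lia.
have -> : y = 1 by lia.
by lia.
Qed.

Lemma hex_dist_adj v u w : hex_adj u w -> (hex_dist v w <= (hex_dist v u).+1)%N.
Proof.
case: u w v => [i j] [k l] [a b]; rewrite /hex_adj /hex_dist /=.
set p := (2 %| a + b)%Z; have pE : p = (2 %| a + b)%Z by [].
move: p pE => p pE.
have subl x y : (hex_norm p (x - 1) y <= (hex_norm p x y).+1)%N.
  rewrite -hex_normNl opprB addrC -[hex_norm p x y]hex_normNl.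
  exact: hex_norm_addl.
have vert x y : (2 %| x + y + (a + b))%Z ->
   (hex_norm p x (y + 1) <= (hex_norm p x y).+1)%N /\
   (hex_norm p x y <= (hex_norm p x (y + 1)).+1)%N.
  case: p pE {subl} => /esym pE xy.
    by rewrite hex_norm_addr ?hex_norm_subr//; lia.
  rewrite !hex_norm_false (_ : - y = - (y + 1) + 1); last by lia.
  by rewrite hex_norm_addr ?hex_norm_subr//; lia.
case/or3P => [/andP[/eqP <- /orP[]/eqP ->]|/and3P[/eqP <- /eqP -> ij]|].
- by rewrite addrAC; exact: hex_norm_addl.
- by rewrite (_ : k - a = k + 1 - a - 1); [exact: subl|lia].
- by rewrite addrAC; case: (vert (i - a) (j - b)) => //; lia.
move=> /and3P[/eqP <- /eqP -> ij].
by rewrite [l + 1 - b]addrAC; case: (vert (i - a) (l - b)) => //; lia.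
Qed.

Lemma hex_dist_pred v u : (0 < hex_dist v u)%N ->
  exists2 w, hex_adj w u & (hex_dist v w < hex_dist v u)%N.
Proof.
move=> vu0.
suff [k uk] : exists k, (hex_dist v (nbr k u) < hex_dist v u)%N.
  by exists (nbr k u) => //; rewrite hex_adj_sym; apply/hex_adjP; exists k.
case: u v vu0 => [i j] [a b]; rewrite /hex_dist /=.
have [ab|ab] := boolP (2 %| a + b)%Z.
  move=> /hex_norm_pred[lt|lt|].
  - by exists 0; rewrite /= addrAC.
  - by exists 1; rewrite /= addrAC.
  rewrite (_ : (2 %| _)%Z = (2 %| i + j)%Z); last by lia.
  move=> lt; exists 2; move: lt; rewrite /= /updown.
  by case: ifP => _; [rewrite [j + 1 - b]addrAC|rewrite [j - 1 - b]addrAC].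
rewrite hex_norm_false => /hex_norm_pred[lt|lt|lt].
- by exists 0; rewrite /= !hex_norm_false addrAC.
- by exists 1; rewrite /= !hex_norm_false addrAC.
exists 2; rewrite /= !hex_norm_false /updown; apply: leq_ltn_trans lt.
rewrite (_ : (2 %| i - a - (j - b))%Z = ~~ (2 %| i + j)%Z); last by lia.
by case: ifP => _ /=; apply: eq_leq; congr hex_norm; lia.
Qed.

(** * Short cycles and closed neighbourhoods *)

Lemma hex_no_triangle (u v w : HEX) : adj u v -> adj v w -> ~~ adj u w.
Proof.
by case: u v w => [i j] [k l] [m n]; rewrite /adj /= /hex_adj /=; lia.
Qed.

Lemma hex_no_square (u v w w' : HEX) : u <> v ->
  adj u w -> adj w v -> adj u w' -> adj w' v -> w = w'.
Proof.
move=> uv /hex_adjP[k ->]; rewrite [adj _ v]hex_adj_sym => /hex_adjP[l e].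
move=> /hex_adjP[k' ->]; rewrite [adj _ v]hex_adj_sym => /hex_adjP[l' e'].
move: uv e e'; case: u v => [i j] [i' j'].
by case: k k' l l' => [[|[|[|//]]] ?] [[|[|[|//]]] ?] [[|[|[|//]]] ?] [[|[|[|//]]] ?] //;
  rewrite /nbr /updown /=; (repeat case: ifP => ?) => uv [? ?] [? ?];
  first [apply/eqP; rewrite xpair_eqE; lia
        | case: uv; apply/eqP; rewrite xpair_eqE; lia].
Qed.

Lemma nbr_inj u : injective (nbr^~ u).
Proof.
case: u => [i j] [[|[|[|//]]] ?] [[|[|[|//]]] ?]; rewrite /nbr /updown /= => /eqP;
  rewrite xpair_eqE => h; apply: val_inj => //=; exfalso; move: h; try case: ifP; lia.
Qed.

Definition cnbhd (v : HEX) : seq HEX := v :: codom (nbr^~ v).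

Lemma mem_cnbhd (v w : HEX) : (w \in cnbhd v) = (w == v) || adj v w.
Proof.
rewrite inE; congr orb; apply/codomP/hex_adjP => -[k kw]; by exists k.
Qed.

Lemma cnbhd_uniq v : uniq (cnbhd v).
Proof.
rewrite /= map_inj_uniq ?enum_uniq ?andbT; last exact: nbr_inj.
by apply/negP => /codomP/hex_adjP; rewrite hex_adj_irrefl.
Qed.

Lemma size_cnbhd v : size (cnbhd v) = 4.
Proof. by rewrite /= size_codom card_ord. Qed.

(** A closed neighbourhood has four vertices. Two non-detectors leave only two others, which serve
    as [a] and [b]. Conversely, if no detector avoids [a] and [b], uniqueness of the non-detector
    fits four vertices into a list of three. *)
Lemma hex_ERR_LDP (S : set HEX) : ERR_LD S <->
  forall v c c' : HEX, c \in cnbhd v -> c' \in cnbhd v ->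
    ~ S c -> ~ S c' -> c = c'.
Proof.
rewrite ERR_LD_girth5; [|exact: hex_no_triangle|exact: hex_no_square].
split=> [dom v c c' vc vc' Sc Sc'|uni v a b].
  apply/eqP/negPn/negP => cc'.
  pose s := rem c' (rem c (cnbhd v)).
  have c's : c' \in rem c (cnbhd v).
    by rewrite mem_rem_uniq ?cnbhd_uniq// inE eq_sym cc'.
  have /(_ s)[] : forall s : seq HEX, size s = 2 -> exists a b, s = [:: a; b].
    by case=> [|? [|? [|]]] // _; eexists; eexists.
    by rewrite /s !size_rem// size_cnbhd.
  move=> a [b sE]; have [w [Sw wa wb]] := dom v a b.
  rewrite (adj_sym w) -mem_cnbhd => vw.
  have : w \in s.
    rewrite mem_rem_uniq ?rem_uniq ?cnbhd_uniq// inE.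
    rewrite mem_rem_uniq ?cnbhd_uniq// inE vw andbT.
    by apply/andP; split; apply/eqP => e; subst w.
  by rewrite sE !inE => /orP[]/eqP.
apply: contrapT => nw.
have {}nw w : w \in cnbhd v -> w <> a -> w <> b -> ~ S w.
  by move=> vw wa wb Sw; apply: nw; exists w; rewrite adj_sym -mem_cnbhd.
have nsub x y z : ~ {subset cnbhd v <= [:: x; y; z]}.
  by move=> /(uniq_leq_size (cnbhd_uniq v)); rewrite size_cnbhd.
have [[c [vc ca cb]]|nc] := pselect (exists c,
  [/\ c \in cnbhd v, c <> a & c <> b]).
  apply: (nsub a b c) => w vw; rewrite !inE.
  have [//|/eqP wa] := eqVneq w a; have [//|/eqP wb] := eqVneq w b.
  by apply/eqP; apply: (uni v) => //; exact: nw.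
apply: (nsub a b b) => w vw; rewrite !inE.
have [//|/eqP wa] := eqVneq w a; have [//|/eqP wb] := eqVneq w b.
by case: nc; exists w; split.
Qed.

(** * Counting tools and the size of balls *)

Lemma card_fset_set_le_range (T : finType) (U : choiceType) (f : T -> U)
    (A : set U) :
  A `<=` range f -> (#|` fset_set A| <= #|T|)%N.
Proof.
move=> Af.
have Afin : finite_set A by apply: sub_finite_set Af _; exact: finite_image.
rewrite cardE; apply: leq_trans (leq_imfset_card imfset_key f (mem T)).
apply: fsubset_leq_card; apply/fsubsetP => x.
rewrite in_fset_set// inE => /Af[t _ <-].
by apply/imfsetP; exists t.
Qed.

Lemma card_fset_set_ge_inj (T : finType) (U : choiceType) (f : T -> U)
    (A : set U) : finite_set A -> injective f -> (forall t, A (f t)) ->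
  (#|T| <= #|` fset_set A|)%N.
Proof.
move=> Afin finj fA; rewrite cardE -(card_imfset imfset_key (mem T) finj).
apply: fsubset_leq_card; apply/fsubsetP => x /imfsetP[t _ ->].
by rewrite in_fset_set// inE.
Qed.

Lemma hex_distvv v : hex_dist v v = 0%N.
Proof. by case: v => i j; rewrite /hex_dist /hex_norm /=; case: ifP; lia. Qed.

Lemma hex_dist_eq0 v u : hex_dist v u = 0%N -> u = v.
Proof.
case: u v => [i j] [k l]; rewrite /hex_dist /hex_norm /= => h.
by apply/eqP; rewrite xpair_eqE; lia.
Qed.

(** [hex_dist] grows by at most one along each edge of a walk, and descending with [hex_dist_pred]
    builds a walk that is short enough. *)
Lemma hex_gballE (v : HEX) (r : nat) :
  gball v r = [set u | (hex_dist v u <= r)%N].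
Proof.
apply/seteqP; split=> u.
  move=> [p [+ + +]]; elim/last_ind: p u r => [|p w IH] u r /=.
    by move=> _ <- _; rewrite hex_distvv.
  rewrite last_rcons size_rcons rcons_path => /andP[vp pw] <-.
  case: r => // r; rewrite ltnS => pr.
  by apply: leq_trans (hex_dist_adj v pw) _; rewrite ltnS; apply: IH.
move=> /=; elim: r u => [|r IH] u ur.
  by exists [::]; split=> //=; rewrite (@hex_dist_eq0 v u)//; lia.
have [u0|u0] := posnP (hex_dist v u).
  by exists [::]; split=> //=; rewrite (@hex_dist_eq0 v u).
have [w wu lt] := hex_dist_pred u0.
have [|p [vp pw pr]] := IH w; first by lia.
by exists (rcons p u); rewrite rcons_path last_rcons size_rcons vp pw; split.
Qed.

Definition hex_ball_size (v : HEX) (r : nat) : nat := #|` fset_set (gball v r)|.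

(* On a sphere of radius [r], either [`|x| + `|y| = r] or [`|y|] is [r./2] or
   [r./2 + 1], hence the at most [(2 * r + 1) * 6] points. *)
Lemma hex_dist_cover (v : HEX) r : let n := r.*2.+1 in
  let f (t : 'I_n * (bool * 'I_3)) : HEX :=
    let x := (t.1 : int) - (r : int) in
    let y : int := match val t.2.2 with
      0 => r%:Z - `|x| | 1 => (r./2)%:Z | _ => (r./2).+1%:Z end in
    (v.1 + x, v.2 + (if t.2.1 then y else - y)) in
  [set u | hex_dist v u = r] `<=` range f.
Proof.
move=> n f [i j] /= h.
set x : int := i - v.1; set y : int := j - v.2.
have xr : (`|x| <= r)%N by rewrite -h /hex_dist /hex_norm /= -/x -/y leq_max leq_addr.
have xn : (absz (x + r%:Z)%R < n)%N by rewrite /n; lia.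
have [k hk] : exists k : 'I_3, `|y| = match val k with
      0 => r%:Z - `|x| | 1 => (r./2)%:Z | _ => (r./2).+1%:Z end.
  have : [\/ `|y| = r%:Z - `|x|, `|y| = (r./2)%:Z | `|y| = (r./2).+1%:Z].
    move: h; rewrite /hex_dist /hex_norm /= -/x -/y => h.
    have : (absz y = r - absz x \/ absz y = r./2 \/ absz y = r./2.+1)%N by lia.
    by case=> [?|[?|?]]; [apply: Or31|apply: Or32|apply: Or33]; lia.
  by case=> ->; [exists 0|exists 1|exists 2].
exists (Ordinal xn, (0 <= y, k)) => //=; rewrite /f /=.
have -> : (absz (x + r%:Z))%:Z - r%:Z = x by lia.
rewrite -hk; congr (_, _); rewrite /x /y; first by rewrite addrC subrK.
have -> : (if 0 <= j - v.2 then `|j - v.2| else - `|j - v.2|) = j - v.2.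
  by case: ifP; lia.
by rewrite addrC subrK.
Qed.

Lemma hex_gball_finite (v : HEX) r : finite_set (gball v r).
Proof.
rewrite hex_gballE; elim: r => [|r IH].
  by apply: sub_finite_set (finite_set1 v) => u /=; rewrite leqn0 => /eqP/hex_dist_eq0.
have : finite_set ([set u | (hex_dist v u <= r)%N] `|` [set u | hex_dist v u = r.+1]).
  rewrite finite_setU; split=> //; apply: sub_finite_set (@hex_dist_cover v r.+1) _.
  exact: finite_image.
by apply: sub_finite_set => u /=; rewrite leq_eqVlt ltnS => /orP[/eqP|]; [right|left].
Qed.

Lemma hex_ball_sizeS (v : HEX) r :
  (hex_ball_size v r.+1 <= hex_ball_size v r + 6 * (2 * r + 3))%N.
Proof.
(* The cover at radius [r.+1] has [2 * r.+1 + 1] abscissas, hence the factor [2 * r + 3]. *)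
have := card_fset_set_le_range (@hex_dist_cover v r.+1).
rewrite !card_prod !card_ord card_bool => h.
have fin : finite_set [set u | hex_dist v u = r.+1].
  by apply: sub_finite_set (@hex_gball_finite v r.+1) => u; rewrite hex_gballE /= => ->.
rewrite /hex_ball_size (_ : gball v r.+1 = gball v r `|` [set u | hex_dist v u = r.+1]).
  rewrite fset_setU//; last exact: hex_gball_finite.
  rewrite (leq_trans (leq_card_fsetU _ _).1)// leq_add2l (leq_trans h)//; lia.
rewrite !hex_gballE; apply/seteqP; split=> u /=.
  by rewrite leq_eqVlt ltnS => /orP[/eqP|]; [right|left].
by case=> [|->//]; apply: leqW.
Qed.

(** A square block with corner [v] fits into the ball: offsets are at most [(r.+1)./2 - 1], and a
    vertical offset costs about twice its size. *)
Lemma hex_ball_size_ge (v : HEX) r : (((r.+1)./2) ^ 2 <= hex_ball_size v r)%N.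
Proof.
pose f (t : 'I_((r.+1)./2) * 'I_((r.+1)./2)) : HEX := (v.1 + t.1%:Z, v.2 + t.2%:Z).
have := @card_fset_set_ge_inj _ _ f (gball v r) (hex_gball_finite v r).
rewrite card_prod card_ord mulnn; apply.
  by move=> [a b] [c d] [? ?]; congr (_, _); apply: val_inj => /=; lia.
move=> [[a ?] [b ?]]; rewrite hex_gballE /f /hex_dist /hex_norm /=; lia.
Qed.

Lemma hex_ball_size_gt0 (v : HEX) r : (0 < hex_ball_size v r)%N.
Proof.
rewrite cardfs_gt0; apply/fset0Pn; exists v.
by rewrite in_fset_set; [rewrite inE hex_gballE /= hex_distvv|exact: hex_gball_finite].
Qed.

(* The constant: [6 * (2 * r + 3) * r.+1 <= 42 * r ^ 2 + 18] while the ball has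
   at least [r ^ 2 / 4] points, and at least one. *)
Lemma hex_ball_growth (v : HEX) r :
  (r.+1 * (hex_ball_size v r.+1 - hex_ball_size v r) <= 250 * hex_ball_size v r)%N.
Proof.
have := hex_ball_sizeS v r; have := hex_ball_size_ge v r.
have := hex_ball_size_gt0 v r.
set b := hex_ball_size v r; set b' := hex_ball_size v r.+1 => b0 rb bb'.
have : (r <= 2 * (r.+1)./2)%N by lia.
set q := (r.+1)./2 in rb * => rq.
have r2b : (r * r <= 4 * b)%N by nia.
have : (b' - b <= 6 * (2 * r + 3))%N by lia.
nia.
Qed.

(** * Limits superior with a harmonic error term *)

Lemma le_limn_esup (R : realType) (u v : (\bar R)^nat) :
  (forall n, u n <= v n)%E -> (limn_esup u <= limn_esup v)%E.
Proof.
move=> uv; rewrite !limn_esup_lim; apply: lee_lim.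
- exact: is_cvg_esups.
- exact: is_cvg_esups.
- apply: nearW => n; apply: ge_ereal_sup => _ [m /= nm <-].
  by apply: le_trans (uv m) _; apply: ereal_sup_ubound; exists m.
Qed.

Lemma limn_esup_harmonic (R : realType) (l c : R) :
  limn_esup (fun n => (l + c * harmonic n)%:E) = l%:E.
Proof.
have h : (fun n => (l + c * harmonic n)%:E) @ \oo --> l%:E.
  apply: cvg_EFin; first exact: nearW.
  rewrite -[X in _ --> X]addr0 -[X in _ + X](mulr0 c).
  apply: cvgD; first exact: cvg_cst.
  apply: cvgMl_tmp; exact: cvg_harmonic.
rewrite is_cvg_limn_esupE; last by apply/cvg_ex; exists l%:E.
exact/cvg_lim.
Qed.

(** * Double counting between [S] and its complement *)

Lemma hex_gball_nbr (v u : HEX) r k :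
  gball v r u -> gball v r.+1 (nbr k u).
Proof.
rewrite !hex_gballE /= => ur.
have uk : hex_adj u (nbr k u) by apply/hex_adjP; exists k.
exact: leq_trans (hex_dist_adj v uk) _.
Qed.

Lemma hex_ball_sizeE (v : HEX) r (S : set HEX) : hex_ball_size v r =
  (#|` fset_set (gball v r `&` S)| + #|` fset_set (gball v r `\` S)|)%N.
Proof.
have fin := hex_gball_finite v r.
have finS : finite_set (gball v r `&` S) by exact: finite_setIl.
have finD : finite_set (gball v r `\` S) by exact: finite_setD.
rewrite -cardfsUI -fset_setU// -fset_setI// setDE setIACA setICr setI0 fset_set0.
by rewrite cardfs0 addn0 -setIUr setUCr setIT.
Qed.

(** The map sending a direction and a non-detector to the neighbour is injective: a shared neighbour
    would have two non-detectors in its closed neighbourhood. Its values are detectors by the same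
    uniqueness around [c]. *)
Lemma card_ball_compl_le (v : HEX) r (S : set HEX) : ERR_LD S ->
  (3 * #|` fset_set (gball v r `\` S)| <= #|` fset_set (gball v r.+1 `&` S)|)%N.
Proof.
move=> /hex_ERR_LDP uni.
have finD : finite_set (gball v r `\` S).
  by apply: finite_setD; exact: hex_gball_finite.
set F := fset_set (gball v r `\` S).
have FP (c : F) : (gball v r `\` S) (val c).
  by have := valP c; rewrite in_fset_set// inE.
pose f (t : 'I_3 * F) : HEX := nbr t.1 (val t.2).
have := @card_fset_set_ge_inj _ _ f (gball v r.+1 `&` S).
rewrite card_prod card_ord -cardfE; apply.
- by apply: finite_setIl; exact: hex_gball_finite.
- move=> [k c] [k' c']; rewrite /f /= => e.
  have cc' : c = c'.
    apply: val_inj; apply: (uni (nbr k (val c))); rewrite ?mem_cnbhd;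
      try by case: (FP c); case: (FP c').
    + by apply/orP; right; rewrite adj_sym; apply/hex_adjP; exists k.
    + by apply/orP; right; rewrite adj_sym e; apply/hex_adjP; exists k'.
  by move: e; rewrite cc' => /nbr_inj ->.
move=> [k c]; have [cv cS] := FP c; split; first exact: hex_gball_nbr.
apply: contrapT => nS; have : nbr k (val c) = val c.
  apply: (uni (val c)) => //; rewrite mem_cnbhd ?eqxx//.
  by apply/orP; right; apply/hex_adjP; exists k.
have /hex_adjP : exists k', nbr k (val c) = nbr k' (val c) by exists k.
by move=> + e; rewrite e hex_adj_irrefl.
Qed.

Lemma card_ball_le_compl (v : HEX) r (S : set HEX) :
  (forall u, S u -> exists k, ~ S (nbr k u)) ->
  (#|` fset_set (gball v r `&` S)| <= 3 * #|` fset_set (gball v r.+1 `\` S)|)%N.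
Proof.
move=> dom.
have finD : finite_set (gball v r.+1 `\` S).
  by apply: finite_setD; exact: hex_gball_finite.
set F := fset_set (gball v r.+1 `\` S).
pose f (t : 'I_3 * F) : HEX := nbr t.1 (val t.2).
have := @card_fset_set_le_range _ _ f (gball v r `&` S).
rewrite card_prod card_ord -cardfE; apply => u [vu /dom[k nS]].
have kF : nbr k u \in F.
  by rewrite in_fset_set// inE; split=> //; exact: hex_gball_nbr.
have /hex_adjP[k' uE] : hex_adj (nbr k u) u.
  by rewrite hex_adj_sym; apply/hex_adjP; exists k.
by exists (k', [` kF]%fset).
Qed.

(** * The perfect code *)

Definition hex_code_compl : set HEX := [set u | ~~ (4 %| u.1 + u.2 * 2)%Z].

(** Horizontal steps change [i + 2 j] by 1 and -1, the vertical one by 2 modulo 4. So a closed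
    neighbourhood meets each residue exactly once; existence of the code vertex is used here,
    uniqueness in the next lemma. *)
Lemma hex_code_compl_dom u : hex_code_compl u ->
  exists k, ~ hex_code_compl (nbr k u).
Proof.
rewrite /hex_code_compl; case: u => [i j] /= ij.
have : [\/ (4 %| i + 1 + j * 2)%Z, (4 %| i - 1 + j * 2)%Z |
    (4 %| i + updown i j * 2)%Z].
  rewrite /updown; have [?|?] := boolP (4 %| i + 1 + j * 2)%Z; first exact: Or31.
  have [?|?] := boolP (4 %| i - 1 + j * 2)%Z; first exact: Or32.
  by apply: Or33; case: ifP; lia.
by case=> h; [exists 0|exists 1|exists 2]; apply/negP; rewrite negbK.
Qed.

Lemma hex_code_compl_ERR_LD : ERR_LD hex_code_compl.
Proof.
apply/hex_ERR_LDP => v c c'; rewrite !mem_cnbhd /hex_code_compl.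
case: v c c' => [i j] [k l] [m n] /= vc vc' /negP + /negP.
rewrite !negbK => hc hc'; apply/eqP; rewrite xpair_eqE.
move: vc vc' hc hc'; rewrite /adj /= /hex_adj /= !xpair_eqE.
by lia.
Qed.

(** * From counting to density *)

Lemma card_ball_monotone (v : HEX) r (S : set HEX) :
  (#|` fset_set (gball v r `&` S)| <= #|` fset_set (gball v r.+1 `&` S)|)%N.
Proof.
have fin n : finite_set (gball v n `&` S).
  by apply: finite_setIl; exact: hex_gball_finite.
apply: fsubset_leq_card; rewrite -fset_set_sub//; apply: setSI.
by rewrite !hex_gballE => u /=; exact: leqW.
Qed.

(** Double counting and monotonicity give [3 * |B_r| <= 4 * |B_(r+1) & S|]. Replacing [B_r] by
    [B_(r+1)] costs three times the sphere; as [r + 2 <= 2 * (r + 1)], the growth bound yields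
    [3 * 2 * 250 = 1500]. *)
Lemma ERR_LD_card_ball (v : HEX) r (S : set HEX) : ERR_LD S ->
  (3 * r.+1 * hex_ball_size v r <=
   4 * r.+1 * #|` fset_set (gball v r `&` S)| + 1500 * hex_ball_size v r)%N.
Proof.
move=> SE; case: r => [|r]; first by lia.
have := card_ball_compl_le v r SE; have := card_ball_monotone v r S.
have := hex_ball_sizeE v r S; have := hex_ball_growth v r.
by nia.
Qed.

Lemma dominated_card_ball (v : HEX) r (S : set HEX) :
  (forall u, S u -> exists k, ~ S (nbr k u)) ->
  (4 * r.+1 * #|` fset_set (gball v r `&` S)| <=
   3 * r.+1 * hex_ball_size v r + 1500 * hex_ball_size v r)%N.
Proof.
move=> dom.
have := card_ball_le_compl v r dom; have := card_ball_monotone v r S.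
have := hex_ball_sizeE v r.+1 S; have := hex_ball_growth v r.
by nia.
Qed.

Lemma le_hex_density (R : realType) (S : set HEX) (v : HEX) : ERR_LD S ->
  ((3%:R / 4%:R : R)%:E <= density R v S)%E.
Proof.
(* Dividing the counting bound by [4 * r.+1 * |B_r|] leaves the error [375 / r.+1], with
   [375 = 1500 / 4]. *)
move=> SE; rewrite -(limn_esup_harmonic _ (- 375%:R)); apply: le_limn_esup => r.
rewrite lee_fin -/(hex_ball_size v r).
have b0 : 0 < (hex_ball_size v r)%:R :> R by rewrite ltr0n hex_ball_size_gt0.
have := ERR_LD_card_ball v r SE.
rewrite -(ler_nat R) natrD !natrM => h.
rewrite ler_pdivlMr// /harmonic /=.
have n0 : 0 < (r.+1)%:R :> R by rewrite ltr0n.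
have e : (r.+1)%:R * (3%:R / 4%:R + - 375%:R * (r.+1)%:R^-1) =
    (r.+1)%:R * (3%:R / 4%:R) - 375%:R :> R.
  by rewrite mulrDr [X in _ + X]mulrCA divff ?gt_eqF// mulr1.
by rewrite -(ler_pM2l n0) mulrA e; lra.
Qed.

Lemma hex_density_le (R : realType) (S : set HEX) (v : HEX) :
  (forall u, S u -> exists k, ~ S (nbr k u)) ->
  (density R v S <= (3%:R / 4%:R : R)%:E)%E.
Proof.
move=> dom; rewrite -(limn_esup_harmonic _ (375%:R)); apply: le_limn_esup => r.
rewrite lee_fin -/(hex_ball_size v r).
have b0 : 0 < (hex_ball_size v r)%:R :> R by rewrite ltr0n hex_ball_size_gt0.
have := dominated_card_ball v r dom.
rewrite -(ler_nat R) natrD !natrM => h.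
rewrite ler_pdivrMr// /harmonic /=.
have n0 : 0 < (r.+1)%:R :> R by rewrite ltr0n.
have e : (r.+1)%:R * (3%:R / 4%:R + 375%:R * (r.+1)%:R^-1) =
    (r.+1)%:R * (3%:R / 4%:R) + 375%:R :> R.
  by rewrite mulrDr [X in _ + X]mulrCA divff ?gt_eqF// mulr1.
by rewrite -(ler_pM2l n0) [leRHS]mulrA e; lra.
Qed.
Theorem theorem4p5 (R : realType) :
  is_ERR_LD_density HEX ((3%:R / 4%:R : R)%:E).
Proof.
split=> [|S SE v]; last exact: le_hex_density.
exists hex_code_compl; first exact: hex_code_compl_ERR_LD.
move=> v; apply/eqP; rewrite eq_le; apply/andP; split.
  exact/hex_density_le/hex_code_compl_dom.
exact/le_hex_density/hex_code_compl_ERR_LD.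
Qed.
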